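(* Let $(r_n)_{n\ge1}\in\mathrm{P}_d$. Then for $\mathcal{L}^d$-almost every $x\in\mathbb{R}^d$, the sequence $(\{nx\})_{n\ge1}$ is eutaxic in $(0,1)^d$ with respect to $(r_n)_{n\ge1}$, i.e. for $\mathcal{L}^d$-almost every $y\in(0,1)^d$ there are infinitely many $n\ge1$ with $|y-\{nx\}|<r_n$.
   Context: Fix a norm $|\cdot|$ on $\mathbb{R}^d$; $\mathcal{L}^d$ is Lebesgue measure. $\{z\}$ denotes the coordinatewise fractional part of $z\in\mathbb{R}^d$. $\mathrm{P}_d$ is the set of real sequences $(r_n)_{n\ge1}$ with $r_{n+1}\le r_n$ for all $n$, $r_n\to0$ and $\sum_nr_n^d=\infty$. *)

(* Defs.v *)
From mathcomp Require Import ssreflect ssrfun ssrbool eqtype ssrnat seq fintype bigop.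
From Stdlib Require Import Reals.
Open Scope R_scope.

Definition Rd (d : nat) := 'I_d -> R.

Definition vsub {d} (x y : Rd d) : Rd d := fun i => x i - y i.
Definition vadd {d} (x y : Rd d) : Rd d := fun i => x i + y i.
Definition vscal {d} (c : R) (x : Rd d) : Rd d := fun i => c * x i.

Definition is_norm {d} (N : Rd d -> R) : Prop :=
  (forall x, N x = 0 -> forall i, x i = 0) /\
  (forall c x, N (vscal c x) = Rabs c * N x) /\
  (forall x y, N (vadd x y) <= N x + N y).

Definition vfrac {d} (z : Rd d) : Rd d := fun i => frac_part (z i).

Definition box_vol {d} (a b : Rd d) : R :=
  \big[Rmult/1]_(i < d) (b i - a i).

Definition negligible {d} (A : Rd d -> Prop) : Prop :=
  forall eps : R, 0 < eps ->
    exists a b : nat -> Rd d,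
      (forall k i, a k i <= b k i) /\
      (forall x, A x -> exists k, forall i, a k i <= x i <= b k i) /\
      (forall n, sum_f_R0 (fun k => box_vol (a k) (b k)) n <= eps).

Definition ae {d} (P : Rd d -> Prop) : Prop := negligible (fun x => ~ P x).

(* The class P_d (sequences indexed by n >= 1; values at 0 ignored). *)
Definition in_Pd (d : nat) (r : nat -> R) : Prop :=
  (forall n, (1 <= n)%nat -> r (S n) <= r n) /\
  Un_cv r 0 /\
  (forall M : R, exists n : nat, M < sum_f_R0 (fun k => r (S k) ^ d) n).

Definition eutaxic_frac {d} (N : Rd d -> R) (r : nat -> R) (x : Rd d) : Prop :=
  ae (fun y : Rd d =>
        (forall i, 0 < y i < 1) ->
        forall m : nat, exists n : nat,
          (m < n)%nat /\ N (vsub y (vfrac (vscal (INR n) x))) < r n).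

(* Main.v *)
(* The set of y approximated infinitely often is studied for almost every pair
   (x, y), after a discretisation that makes the pairs a finite probability space.
   Fix m, and let p be a prime, large compared with K and with the 1 / r_n for
   m < n <= m + K. Cut the unit cube into p^d cells indexed by (Z/p)^d. For
   distinct n, n' < p the map (a, b) |-> (b - n a, b - n' a) is a bijection of
   (Z/p)^d x (Z/p)^d, so the events "b - n a lies in a cube S_n of side about
   p r_n" are pairwise independent. By Chebyshev, the proportion of pairs that
   avoid them all is at most 1 / sum_n (|S_n| / p^d), which is arbitrarily small
   since sum_n r_n^d diverges. By Markov, apart from few cells a, few cells b are
   missed by a. Both exceptional sets are thus covered by finitely many cells of
   small total volume. *)
Require Import Defs.
From Stdlib Require Import Reals.
From mathcomp Require Import all_boot all_order all_algebra.
From mathcomp Require Import boolp.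
From mathcomp Require Import Rstruct ssrZ ring lra.
Set Implicit Arguments.
Unset Strict Implicit.
Unset Printing Implicit Defensive.
Import Order.TTheory GRing.Theory Num.Theory.
Local Open Scope ring_scope.

(** * Pairwise independent events modulo a prime *)

Lemma sum_card_fibres (I T : finType) (E : I -> {set T}) :
  (\sum_(w : T) \sum_(i : I) (w \in E i)%:R = \sum_(i : I) #|E i|%:R :> int).
Proof.
rewrite exchange_big; apply: eq_bigr => i _ /=.
by rewrite -sum1_card natr_sum [RHS]big_mkcond; apply: eq_bigr => w _; case: (w \in _).
Qed.

(* Chebyshev's inequality, applied to the number of events that occur. *)
Lemma card_avoid_pairwise_independent (I T : finType) (E : I -> {set T}) :
  (forall i j, i != j -> (#|E i :&: E j| * #|T| = #|E i| * #|E j|)%N) ->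
  (#|~: \bigcup_i E i| * \sum_i #|E i| <= #|T| ^ 2)%N.
Proof.
move=> indep.
pose W : int := #|T|%:R; pose S : int := \sum_(i : I) #|E i|%:R.
pose X (w : T) : int := \sum_(i : I) (w \in E i)%:R.
have sumX : \sum_w X w = S by exact: sum_card_fibres.
(* The diagonal terms give [W * S]; off the diagonal, independence gives products that sum to at
   most [S ^+ 2]. *)
have sumX2 : W * \sum_w X w ^+ 2 <= W * S + S ^+ 2.
  have -> : \sum_w X w ^+ 2 = \sum_i \sum_j #|E i :&: E j|%:R.
    transitivity (\sum_w \sum_i \sum_j (w \in E i :&: E j)%:R : int).
      apply: eq_bigr => w _; rewrite expr2 mulr_suml; apply: eq_bigr => i _.
      rewrite mulr_sumr; apply: eq_bigr => j _.
      by rewrite inE -natrM mulnb.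
    rewrite exchange_big; apply: eq_bigr => i _ /=.
    exact: (sum_card_fibres (fun j => E i :&: E j)).
  rewrite expr2 mulr_suml {1}/S !mulr_sumr -big_split; apply: ler_sum => i _ /=.
  rewrite /S !mulr_sumr (bigD1 i) //= setIid lerD2l.
  rewrite [leRHS](bigD1 i) //= -[leLHS]add0r lerD ?mulr_ge0 //.
  by apply: ler_sum => j ji; rewrite -!natrM mulnC indep // eq_sym.
(* The variance, with the deviation from the mean [S / W] scaled by [W] to stay in the integers. *)
have var : \sum_w (W * X w - S) ^+ 2 <= W ^+ 2 * S.
  have -> : \sum_w (W * X w - S) ^+ 2 = W * (W * \sum_w X w ^+ 2) - W * S ^+ 2.
    transitivity (\sum_w (W ^+ 2 * X w ^+ 2 - (W * S *+ 2) * X w + S ^+ 2)).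
      by apply: eq_bigr => w _; ring.
    rewrite !big_split sumrN -!mulr_sumr sumX sumr_const /=.
    by rewrite -[S *+ _]mulr_natl -/W; ring.
  have W0 : 0 <= W by [].
  have := ler_wpM2l W0 sumX2; rewrite mulrDr => h.
  by rewrite lerBlDr (le_trans h) // expr2 -mulrA.
have S0 : 0 <= S by apply: sumr_ge0.
suff : #|~: \bigcup_i E i|%:R * S <= W ^+ 2.
  by rewrite /S /W -natr_sum -natrM -natrX ler_nat.
have [->|Sn0] := eqVneq S 0; first by rewrite mulr0 sqr_ge0.
(* After multiplication by [S], each point avoiding all events has [X w = 0] and contributes
   [S ^+ 2] to the sum bounded by [var]. *)
rewrite -(@ler_pM2r _ S) ?lt_def ?Sn0 //; apply: le_trans var.
rewrite (bigID (mem (~: \bigcup_i E i))) /= -[X in X <= _]addr0 lerD //; last first.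
  by apply: sumr_ge0 => w _; rewrite sqr_ge0.
rewrite -mulrA -expr2 mulr_natl -sumr_const ler_sum // => w.
rewrite inE => /bigcupP wE.
have -> : X w = 0.
  rewrite /X big1 // => i _; case: (boolP (w \in E i)) => // h.
  by case: wE; exists i.
by rewrite mulr0 sub0r sqrrN.
Qed.

(** * Hits in a finite abelian group with restricted torsion *)

Section Torsion.

Variables (G : finZmodType) (p : nat).
Hypothesis torsion : forall (a : G) k, (0 < k < p)%N -> a *+ k = 0 -> a = 0.

Definition hit (n : nat) (S : {set G}) : {set G * G} :=
  [set ab | ab.2 - ab.1 *+ n \in S].

Lemma card_hit n S : #|hit n S| = (#|G| * #|S|)%N.
Proof.
pose f (ab : G * G) := (ab.1, ab.2 - ab.1 *+ n).
have finj : injective f by move=> [a b] [a' b'] [<-] /addIr <-.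
have -> : hit n S = f @^-1: setX setT S by apply/setP => ab; rewrite !inE.
by rewrite (card_preimset _ finj) cardsX cardsT.
Qed.

(** The two values differ by [a *+ (l - k)] with [0 < l - k < p], so they determine [a], and then
    [b]; an injective self-map of a finite set is a bijection. *)
Lemma card_hitI n m S S' : (n < p)%N -> (m < p)%N -> n != m ->
  #|hit n S :&: hit m S'| = (#|S| * #|S'|)%N.
Proof.
move=> np mp nm.
pose f (ab : G * G) := (ab.2 - ab.1 *+ n, ab.2 - ab.1 *+ m).
have key (k l : nat) (a b a' b' : G) : (k < l < p)%N ->
    b - a *+ k = b' - a' *+ k -> b - a *+ l = b' - a' *+ l -> (a, b) = (a', b').
  move=> /andP[kl lp] e1 e2.
  have ea : a = a'.
    apply/eqP; rewrite -subr_eq0; apply/eqP; apply: (@torsion _ (l - k)%N).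
      by rewrite subn_gt0 kl (leq_ltn_trans (leq_subr _ _)).
    have aE (c d : G) : c *+ (l - k) = (d - c *+ k) - (d - c *+ l).
      by rewrite mulrnBr ?(ltnW kl) // opprB [RHS]addrC addrA subrK.
    by rewrite mulrnBl (aE a b) (aE a' b') e1 e2 subrr.
  by move: e1; rewrite ea => /addIr ->.
have finj : injective f.
  move=> [a b] [a' b'] [e1 e2].
  by case: (ltngtP n m) nm => // nm _; [apply: (key n m)|apply: (key m n)] => //;
     rewrite nm.
have -> : hit n S :&: hit m S' = f @^-1: setX S S' by apply/setP => ab; rewrite !inE.
by rewrite (card_preimset _ finj) cardsX.
Qed.

(** Chebyshev bounds the avoiding pairs, counted here fibre by fibre over [a]; a factor [#|G|]
    coming from [card_hit] cancels. *)
Lemma card_unhit (K : nat) (n : 'I_K -> nat) (S : 'I_K -> {set G}) :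
  injective n -> (forall i, n i < p)%N ->
  ((\sum_(a : G) #|[set b | [forall i, (a, b) \notin hit (n i) (S i)]]|)
     * \sum_i #|S i| <= #|G| ^ 3)%N.
Proof.
move=> ninj np.
have G0 : (0 < #|G|)%N by apply/card_gt0P; exists 0.
have := @card_avoid_pairwise_independent _ _ (fun i => hit (n i) (S i)).
have -> : (\sum_i #|hit (n i) (S i)| = #|G| * \sum_i #|S i|)%N.
  by rewrite big_distrr; apply: eq_bigr => i _; rewrite card_hit.
rewrite card_prod => avoid.
pose Z (a : G) := [set b | [forall i, (a, b) \notin hit (n i) (S i)]].
have : (#|~: \bigcup_i hit (n i) (S i)| * (#|G| * \sum_i #|S i|) <= (#|G| * #|G|) ^ 2)%N.
  apply: avoid => i j ij; rewrite card_hitI ?inj_eq ?np // !card_hit.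
  by rewrite mulnC mulnACA.
have -> : (#|~: \bigcup_i hit (n i) (S i)| = \sum_(a : G) #|Z a|)%N.
  transitivity (\sum_(a : G) \sum_(b in Z a) 1)%N; last first.
    by apply: eq_bigr => a _; rewrite sum1_card.
  rewrite -sum1_card pair_big_dep /=; apply: eq_bigl => -[a b] /=.
  rewrite !inE /=; apply/negP/forallP => [h i|h /bigcupP[i _ hi]].
    by apply/negP => hi; apply: h; apply/bigcupP; exists i.
  by have := h i; rewrite hi.
move=> h; rewrite -(leq_pmul2l G0) mulnCA -expnS (leq_trans h) //.
by rewrite mulnn -expnM.
Qed.

(** Markov's inequality in [a]: each large fibre contributes at least [c] to the count in
    [card_unhit]. *)
Lemma card_large_unhit (K c : nat) (n : 'I_K -> nat) (S : 'I_K -> {set G}) :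
  injective n -> (forall i, n i < p)%N ->
  (#|[set a | c <= #|[set b | [forall i, (a, b) \notin hit (n i) (S i)]]|]|
     * c * \sum_i #|S i| <= #|G| ^ 3)%N.
Proof.
move=> ninj np; apply: leq_trans (card_unhit S ninj np).
rewrite leq_mul2r; apply/orP; right.
set large := [set a | _].
rewrite -sum_nat_const [leqRHS](bigID (mem large)) /=.
by apply: leq_trans (leq_addr _ _); apply: leq_sum => a; rewrite inE.
Qed.

End Torsion.

(** * Cubes in the row space over the field with [p] elements *)

Section ModP.

Variables (p d : nat).
Hypothesis p_prime : prime p.

Lemma Fp_row_torsion (a : 'rV['F_p]_d) k : (0 < k < p)%N -> a *+ k = 0 -> a = 0.
Proof.
move=> /andP[k0 kp] /rowP ak; apply/rowP => i; have := ak i.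
rewrite mulmxnE !mxE -mulr_natl => /eqP; rewrite mulf_eq0 => /orP[|/eqP //].
by rewrite -(dvdn_pcharf (pchar_Fp p_prime)) gtnNdvd.
Qed.

Lemma card_Fp_row : #|{: 'rV['F_p]_d}| = (p ^ d)%N.
Proof. by rewrite card_mx mul1n card_Fp. Qed.

(** Anchored at 0 instead of centred, so that membership is a bound on canonical representatives in
    [nat]. *)
Definition cube (s : nat) : {set 'rV['F_p]_d} :=
  [set c : 'rV['F_p]_d | [forall i, (c 0%R i < s)%N]].

Lemma card_cube s : (s <= p)%N -> #|cube s| = (s ^ d)%N.
Proof.
move=> sp.
have card_lt : #|[pred x : 'F_p | (x < s)%N]| = s.
  have sF : (s <= (Zp_trunc (pdiv p)).+2)%N by rewrite Fp_cast.
  have winj : injective (widen_ord sF) by move=> i j /(congr1 val) /= ij; apply: val_inj.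
  rewrite -[RHS]card_ord -(card_imset _ winj).
  apply: eq_card => x; rewrite !inE; apply/idP/imsetP => [xs|[i _ ->]] //=.
  by exists (Ordinal xs) => //; apply: val_inj.
pose f (g : {ffun 'I_d -> 'F_p}) : 'rV['F_p]_d := \row_i g i.
have finj : injective f by move=> g h /rowP e; apply/ffunP => i; have := e i; rewrite !mxE.
rewrite -[in RHS]card_lt -[d in RHS]card_ord -card_ffun_on -(card_imset _ finj).
apply: eq_card => c; rewrite !inE; apply/forallP/imsetP => [h|[g /ffun_onP h ->] i].
  exists [ffun i => c 0 i]; last by apply/rowP => i; rewrite mxE ffunE.
  by apply/ffun_onP => i; rewrite ffunE; apply: h.
by rewrite mxE; apply: h.
Qed.

(* The congruence b - n a = c modulo p, lifted to nat without subtraction. *)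
Lemma hit_cubeP n s (a b : 'rV['F_p]_d) : (a, b) \in hit n (cube s) ->
  forall i, exists q c : nat, (c < s)%N /\ (n * a 0%R i + c = b 0%R i + p * q)%N.
Proof.
rewrite !inE => /forallP h i; have := h i.
rewrite !(mxE, mulmxnE); set c : 'F_p := _ - _ => cs.
exists ((n * a 0%R i + c) %/ p)%N, c; split => //.
have -> : (b 0 i : nat) = ((n * a 0%R i + c) %% p)%N.
  have -> : b 0 i = ((n * a 0%R i + c)%N)%:R.
    by rewrite natrD natrM !natr_Zp /c mulr_natl addrC subrK.
  by rewrite val_Fp_nat.
by rewrite [RHS]addnC [(p * _)%N]mulnC -divn_eq.
Qed.

End ModP.

(** * Covers by boxes and negligible sets *)

Lemma negligible_sub d (A B : Rd d -> Prop) : (forall x, A x -> B x) ->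
  negligible B -> negligible A.
Proof.
move=> AB nB e e0; have [a [b [ab [cvr vol]]]] := nB e e0.
by exists a, b; split=> //; split=> // x /AB /cvr.
Qed.

(** The value [e] is kept fixed because the main estimate concerns points whose missed set has no
    cover of volume [e]. *)
Definition covered d (A : Rd d -> Prop) (e : R) : Prop :=
  exists a b : nat -> Rd d,
    (forall k i, a k i <= b k i) /\
    (forall x, A x -> exists k, forall i, a k i <= x i <= b k i) /\
    (forall n, \sum_(0 <= k < n) box_vol (a k) (b k) <= e).

Lemma negligibleP d (A : Rd d -> Prop) :
  negligible A <-> forall e : R, 0 < e -> covered A e.
Proof.
split=> nA e e0.
  have [a [b [ab [cvr vol]]]] := nA e (elimT RltP e0).
  exists a, b; split=> [k i|]; first exact/RleP.
  split=> [x /cvr[k hk]|[|n]].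
  - by exists k => i; have [/RleP-> /RleP->] := hk i.
  - by rewrite big_geq ?ltW.
  - by rewrite -sum_f_R0E; apply/RleP.
have [a [b [ab [cvr vol]]]] := nA e (introT RltP e0).
exists a, b; split=> [k i|]; first exact/RleP.
split=> [x /cvr[k hk]|n]; last by apply/RleP; rewrite sum_f_R0E.
by exists k => i; have /andP[/RleP ? /RleP ?] := hk i.
Qed.

Lemma box_volE d (a b : Rd d) : box_vol a b = \prod_(i < d) (b i - a i).
Proof. by []. Qed.

Lemma box_vol_ge0 d (a b : Rd d) : (forall i, a i <= b i) -> 0 <= box_vol a b.
Proof. by move=> ab; rewrite box_volE prodr_ge0 // => i _; rewrite subr_ge0. Qed.

(** Degenerate boxes serve as padding in sequences of boxes; in dimension 0 the empty product would
    give them volume 1. *)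
Lemma box_vol_point d (a : Rd d) : (0 < d)%N -> box_vol a a = 0.
Proof. by case: d a => // d a _; rewrite box_volE big_ord_recl subrr mul0r. Qed.

Lemma covered_sub d (A B : Rd d -> Prop) (e : R) : (forall x, A x -> B x) ->
  covered B e -> covered A e.
Proof.
by move=> AB [a [b [ab [cvr vol]]]]; exists a, b; split=> //; split=> // x /AB /cvr.
Qed.

Lemma sum_nth_le (v : seq R) n : (forall x, x \in v -> 0 <= x) ->
  \sum_(0 <= k < n) v`_k <= \sum_(x <- v) x.
Proof.
elim: v n => [|x v IH] n v0; first by rewrite big_nil big1 // => k _; rewrite nth_nil.
have v0' y : y \in v -> 0 <= y by move=> yv; apply: v0; rewrite inE yv orbT.
case: n => [|n]; first by rewrite big_geq // big_seq sumr_ge0.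
by rewrite big_nat_recl // big_cons lerD2l IH.
Qed.

(** The finite list of boxes is continued by the point box at the origin, of volume 0. *)
Lemma covered_finite d (J : finType) (S : {set J}) (a b : J -> Rd d)
    (A : Rd d -> Prop) (e : R) : (0 < d)%N ->
  (forall j i, a j i <= b j i) ->
  (forall x, A x -> exists2 j, j \in S & forall i, a j i <= x i <= b j i) ->
  \sum_(j in S) box_vol (a j) (b j) <= e -> covered A e.
Proof.
move=> d0 ab cvr vol.
pose o : Rd d := fun=> 0.
pose s := [seq (a j, b j) | j <- enum S].
pose v := [seq box_vol (a j) (b j) | j <- enum S].
have sz : size s = size v by rewrite !size_map.
have nth_s k : (k < size s)%N -> exists2 j, j \in S & nth (o, o) s k = (a j, b j).
  move=> ks; have [j0 _] : exists j, j \in enum S.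
    by move: ks; rewrite /s size_map; case: (enum S) => // j ? _; exists j; rewrite inE eqxx.
  rewrite size_map in ks; exists (nth j0 (enum S) k); last by rewrite (nth_map j0).
  by rewrite -mem_enum mem_nth.
exists (fun k => (nth (o, o) s k).1), (fun k => (nth (o, o) s k).2); split=> [k i|].
  have [ks|ks] := ltnP k (size s); last by rewrite nth_default.
  by have [j _ ->] := nth_s k ks; apply: ab.
split=> [x /cvr[j jS hj]|n].
  exists (index j (enum S)) => i.
  by rewrite (nth_map j) ?index_mem ?mem_enum // nth_index ?mem_enum //; apply: hj.
apply: le_trans vol; rewrite -big_enum -[leRHS](big_map _ xpredT id) -/v.
rewrite (eq_bigr (fun k => v`_k)); last first.
  move=> k _; have [ks|ks] := ltnP k (size s); last first.
    by rewrite !nth_default -?sz //= box_vol_point.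
  have -> : v = [seq box_vol q.1 q.2 | q <- s] by rewrite /s -map_comp.
  by rewrite (nth_map (o, o)).
by apply: sum_nth_le => x /mapP[j _ ->]; apply: box_vol_ge0.
Qed.

Lemma covered_le d (A : Rd d -> Prop) (e e' : R) : e <= e' -> covered A e -> covered A e'.
Proof.
move=> ee' [a [b [ab [cvr vol]]]]; exists a, b; split=> //; split=> // n.
exact: le_trans (vol n) ee'.
Qed.

(** The set of code [j] gets a cover of volume [e / 2 ^+ j.+1], and the boxes of all these covers
    are enumerated through a coding of pairs. *)
Lemma negligible_bigcup d (T : countType) (A : T -> Rd d -> Prop) : (0 < d)%N ->
  (forall t, negligible (A t)) -> negligible (fun x => exists t, A t x).
Proof.
move=> d0 nA; apply/negligibleP => e e0.
pose B j x := if unpickle j is Some t then A t x else False.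
have covB j : exists ab : (nat -> Rd d) * (nat -> Rd d),
    (forall k i, ab.1 k i <= ab.2 k i) /\
    (forall x, B j x -> exists k, forall i, ab.1 k i <= x i <= ab.2 k i) /\
    (forall n, \sum_(0 <= k < n) box_vol (ab.1 k) (ab.2 k) <= e / 2 ^+ j.+1).
  have ej : 0 < e / 2 ^+ j.+1 by rewrite divr_gt0 ?exprn_gt0.
  have : covered (B j) (e / 2 ^+ j.+1).
    rewrite /B; case: (unpickle j) => [t|].
      by have /negligibleP := nA t; apply.
    apply: (@covered_finite _ void set0 (fun=> fun=> 0) (fun=> fun=> 0)) => //.
    by rewrite big_set0 ltW.
  by case=> a [b h]; exists (a, b).
have [ab {}covB] := choice covB.
pose v (q : nat * nat) := box_vol ((ab q.1).1 q.2) ((ab q.1).2 q.2).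
have v0 q : 0 <= v q by apply: box_vol_ge0 => i; have [+ _] := covB q.1; apply.
(* [pickle_inv] answers only on exact codes, so no pair is decoded twice and [s] below has no
   repetition. *)
pose dec k : option (nat * nat) := pickle_inv k.
exists (fun k => if dec k is Some q then (ab q.1).1 q.2 else fun=> 0).
exists (fun k => if dec k is Some q then (ab q.1).2 q.2 else fun=> 0).
split=> [k i|]; first by case: (dec k) => // q; have [+ _] := covB q.1; apply.
split=> [x [t tx]|n].
  have [_ [/(_ x) + _]] := covB (pickle t).
  rewrite /B pickleK => /(_ tx)[k hk]; exists (pickle (pickle t, k)).
  by rewrite /dec pickleK_inv.
pose s := pmap dec (index_iota 0 n).
have us : uniq s by apply: pmap_uniq (iota_uniq _ _); exact: pickle_invK.
have -> : \sum_(0 <= k < n) box_vol (if dec k is Some q then (ab q.1).1 q.2 else fun=> 0)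
    (if dec k is Some q then (ab q.1).2 q.2 else fun=> 0) = \sum_(q <- s) v q.
  rewrite /s; elim: (index_iota 0 n) => [|k l IH]; first by rewrite !big_nil.
  rewrite big_cons IH /=; case: (dec k) => [q|] /=; first by rewrite big_cons.
  by rewrite box_vol_point // add0r.
(* The finitely many pairs in [s] fit in a [J] by [I] rectangle, which is then bounded row by
   row. *)
pose J := (\max_(q <- s) q.1).+1; pose I := (\max_(q <- s) q.2).+1.
have sJI : {subset s <= [seq (j, i) | j <- iota 0 J, i <- iota 0 I]}.
  move=> [j i] qs; apply: allpairs_f; rewrite mem_iota /= add0n ltnS.
    exact: (@leq_bigmax_seq _ s xpredT (fun q => q.1) (j, i) qs).
  exact: (@leq_bigmax_seq _ s xpredT (fun q => q.2) (j, i) qs).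
have ui : uniq [seq (j, i) | j <- iota 0 J, i <- iota 0 I].
  by apply: allpairs_uniq; rewrite ?iota_uniq // => -[? ?] [? ?].
have sE : perm_eq s [seq q <- [seq (j, i) | j <- iota 0 J, i <- iota 0 I] | q \in s].
  apply: uniq_perm; rewrite ?filter_uniq // => q; rewrite mem_filter.
  by apply/idP/andP => [qs|[]//]; split=> //; apply: sJI.
rewrite (perm_big _ sE) big_filter big_mkcond /=.
apply: (@le_trans _ _ (\sum_(q <- [seq (j, i) | j <- iota 0 J, i <- iota 0 I]) v q)).
  by apply: ler_sum => q _; case: ifP => _; [exact: lexx|exact: v0].
rewrite big_allpairs; apply: (@le_trans _ _ (\sum_(0 <= j < J) e / 2 ^+ j.+1)).
  rewrite /index_iota subn0; apply: ler_sum => j _.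
  by have [_ [_ /(_ I)]] := covB j; rewrite /index_iota subn0.
have -> : \sum_(0 <= j < J) e / 2 ^+ j.+1 = e - e / 2 ^+ J.
  elim: (J) => [|j IH]; first by rewrite big_geq // expr0 divr1 subrr.
  have u0 : 2 ^+ j != 0 :> R by rewrite expf_neq0 ?pnatr_eq0.
  by rewrite big_nat_recr //= IH exprS; field.
by rewrite gerBl divr_ge0 ?exprn_ge0 // ltW.
Qed.

Lemma negligible_translate d (c : Rd d) (A : Rd d -> Prop) :
  negligible A -> negligible (fun x => A (vsub x c)).
Proof.
move=> /negligibleP nA; apply/negligibleP => e /nA[a [b [ab [cvr vol]]]].
exists (fun k => vadd (a k) c), (fun k => vadd (b k) c); split=> [k i|].
  by rewrite /vadd lerD2r.
split=> [x /cvr[k hk]|n].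
  exists k => i; have := hk i; rewrite /vsub /vadd RminusE !RplusE => /andP[? ?].
  by apply/andP; split; lra.
apply: le_trans (vol n); apply: ler_sum => k _; rewrite !box_volE le_eqVlt.
by apply/orP; left; apply/eqP/eq_bigr => i _; rewrite /vadd !RplusE; ring.
Qed.

(** * Discretisation of the unit cube *)

(** Half-open, so that its integer translates partition the space. *)
Definition unit_cube d (x : Rd d) : Prop := forall i, 0 <= x i < 1.

(** Closeness to [n x] modulo integer vectors, in the maximum norm; the given norm and the
    fractional parts return only at the end. *)
Definition near d (rho : nat -> R) n (x y : Rd d) : Prop :=
  forall i, exists z : Z, `|y i - n%:R * x i - IZR z| <= rho n.

Definition missed d (rho : nat -> R) m (x y : Rd d) : Prop :=
  unit_cube y /\ forall n, (m < n)%N -> ~ near rho n x y.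

Section Cells.

Variables (p d : nat).
Hypothesis p_prime : prime p.

Let p_gt0 : 0 < p%:R :> R. Proof. by rewrite ltr0n prime_gt0. Qed.

Definition cell_lo (a : 'rV['F_p]_d) : Rd d := fun i => (a 0 i)%:R / p%:R.
Definition cell_hi (a : 'rV['F_p]_d) : Rd d := fun i => (a 0 i).+1%:R / p%:R.

Definition cell_of (x : Rd d) : 'rV['F_p]_d :=
  \row_i (Num.truncn (p%:R * x i))%:R.

Lemma cell_ofP x : unit_cube x ->
  forall i, cell_lo (cell_of x) i <= x i <= cell_hi (cell_of x) i.
Proof.
move=> x01 i; have /andP[x0 x1] := x01 i.
have px0 : 0 <= p%:R * x i by rewrite mulr_ge0 // ltW.
have /andP[lo hi] := truncn_itv px0.
have tp : (Num.truncn (p%:R * x i) < p)%N.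
  by rewrite -(ltr_nat R) (le_lt_trans lo) // gtr_pMr.
rewrite /cell_lo /cell_hi mxE val_Fp_nat // modn_small //.
by rewrite ler_pdivrMr // ler_pdivlMr // ![x i * _]mulrC lo ltW.
Qed.

Lemma box_vol_cell a : box_vol (cell_lo a) (cell_hi a) = p%:R ^- d.
Proof.
rewrite box_volE (eq_bigr (fun=> p%:R^-1)).
  by rewrite prodr_const card_ord exprVn.
move=> i _; rewrite /cell_lo /cell_hi -addn1 natrD; lra.
Qed.

(** With [n a + c = b + p q], the quantity [p (y - n x + q)] lies between [c - n] and [c + 1], hence
    between [-n] and [s]; each of the two bounds on [p * rho n] controls one side. *)
Lemma near_of_hit (rho : nat -> R) n s a b (x y : Rd d) :
  s%:R <= p%:R * rho n -> n%:R <= p%:R * rho n -> (a, b) \in hit n (cube p d s) ->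
  (forall i, cell_lo a i <= x i <= cell_hi a i) ->
  (forall i, cell_lo b i <= y i <= cell_hi b i) -> near rho n x y.
Proof.
move=> s_le n_le /(hit_cubeP p_prime) hab xa yb i.
have [q [c [cs e]]] := hab i.
exists (Z.opp (Z.of_nat q)); rewrite opp_IZR -INR_IZR_INZ INRE RoppE opprK.
have {}e : n%:R * (a 0 i)%:R + c%:R = (b 0 i)%:R + p%:R * q%:R :> R.
  by rewrite -!natrM -!natrD e.
have cs' : c%:R + 1 <= s%:R :> R by rewrite natr1 ler_nat.
have := xa i; rewrite /cell_lo /cell_hi ler_pdivrMr // ler_pdivlMr // -natr1.
have := yb i; rewrite /cell_lo /cell_hi ler_pdivrMr // ler_pdivlMr // -natr1.
move=> /andP[y0 y1] /andP[x0 x1].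
have c0 : 0 <= c%:R :> R by []; have n0 : 0 <= n%:R :> R by [].
have nx0 := ler_wpM2l n0 x0; have nx1 := ler_wpM2l n0 x1.
by rewrite ler_norml; apply/andP; split; rewrite -(ler_pM2l p_gt0); lra.
Qed.

End Cells.

(** Chebyshev bounds the proportion of missed pairs by the inverse of the sum, and Markov splits it
    as [eps * delta]. The halves pay for rounding [p * rho n] down to an integer side. *)
Lemma covered_bad d (rho : nat -> R) m K (eps delta : R) : (0 < d)%N ->
  0 < eps -> 0 <= delta -> (forall n, (m < n)%N -> 0 < rho n <= 1) ->
  1 <= eps * delta * \sum_(i < K) (rho (m.+1 + i)%N / 2) ^+ d ->
  covered (fun x : Rd d => unit_cube x /\ ~ covered (missed rho m x) eps) delta.
Proof.
move=> d0 eps0 delta0 rho01 big_sum.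
pose nn (i : 'I_K) := (m.+1 + i)%N.
have rho_nn i : 0 < rho (nn i) <= 1 by apply: rho01; rewrite leq_addr.
(* A prime beyond every [n / rho n] in the range gives [n <= p * rho n], and also [n < p] since
   [rho n <= 1]. *)
have [p] := prime_above (\sum_i (Num.truncn ((nn i)%:R / rho (nn i)) : nat).+1)%N.
move=> p_gt p_prime.
have p0 : 0 < p%:R :> R by rewrite ltr0n prime_gt0.
have p_big i : (nn i)%:R <= p%:R * rho (nn i).
  have /andP[r0 _] := rho_nn i.
  rewrite -ler_pdivrMr // ltW // (lt_le_trans (truncnS_gt _)) // ler_nat ltnW //.
  by apply: leq_ltn_trans p_gt; rewrite (bigD1 i) //= leq_addr.
have nn_lt i : (nn i < p)%N.
  have /andP[r0 r1] := rho_nn i.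
  apply: leq_ltn_trans p_gt; rewrite (bigD1 i) //= (leq_trans _ (leq_addr _ _)) //.
  rewrite -(ler_nat R) ltW // (le_lt_trans _ (truncnS_gt _)) //.
  by rewrite ler_pdivlMr // ler_piMr.
pose s i := Num.truncn (p%:R * rho (nn i)).
have s_le i : (s i)%:R <= p%:R * rho (nn i).
  by rewrite truncn_le mulr_ge0 // ltW // (andP (rho_nn i)).1.
(* As [p * rho n >= n >= 1], the side is at least 1 and rounding down loses at most half. *)
have s_ge i : p%:R * (rho (nn i) / 2) <= (s i)%:R.
  have := truncnS_gt (p%:R * rho (nn i)); rewrite -natr1 -/(s i).
  have : 1 <= (nn i)%:R :> R by rewrite ler1n.
  have : 1%N%:R <= (s i)%:R :> R.
    rewrite ler_nat truncn_ge_nat; last by rewrite mulr_ge0 // ltW // (andP (rho_nn i)).1.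
    by apply: le_trans (p_big i); rewrite ler_nat.
  lra.
have s_p i : (s i <= p)%N.
  rewrite -(ler_nat R) (le_trans (s_le i)) // -[leRHS]mulr1 ler_pM2l //.
  by case/andP: (rho_nn i).
pose G := 'rV['F_p]_d.
pose Z (a : G) := [set b : G | [forall i, (a, b) \notin hit (nn i) (cube p d (s i))]].
(* The least integer above [eps * p ^ d]: fewer than [c] cells have total volume at most [eps]. *)
pose c := (Num.truncn (eps * p%:R ^+ d)).+1.
pose bad : {set G} := [set a | (c <= #|Z a|)%N].
have bad_le : #|bad|%:R <= delta * p%:R ^+ d.
  have nn_inj : injective nn by move=> i j /addnI; apply: val_inj.
  have := card_large_unhit (@Fp_row_torsion p d p_prime) c (fun i => cube p d (s i)) nn_inj nn_lt.
  rewrite -/bad card_Fp_row //.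
  under eq_bigr do rewrite card_cube //.
  set g : R := p%:R ^+ d; set sg := \sum_(i < K) _ in big_sum => card_bad.
  have g0 : 0 < g by rewrite exprn_gt0.
  have sumE : \sum_i (s i)%:R ^+ d = (\sum_i s i ^ d)%N%:R :> R.
    by rewrite natr_sum; apply: eq_bigr => i _; rewrite natrX.
  have {}card_bad : #|bad|%:R * c%:R * (\sum_i (s i)%:R ^+ d) <= g ^+ 3 :> R.
    by rewrite sumE /g -!natrX -!natrM ler_nat.
  have sum_ge : g * sg <= \sum_i (s i)%:R ^+ d.
    rewrite mulr_sumr; apply: ler_sum => i _; rewrite -exprMn.
    have r0 : 0 <= p%:R * (rho (nn i) / 2).
      by rewrite mulr_ge0 ?divr_ge0 // ltW // (andP (rho_nn i)).1.
    by rewrite lerXn2r ?nnegrE ?(s_ge i).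
  have c_ge : eps * g <= c%:R by rewrite ltW // truncnS_gt.
  have sg0 : 0 <= sg.
    by apply: sumr_ge0 => i _; rewrite exprn_ge0 // divr_ge0 // ltW // (andP (rho_nn i)).1.
  (* This is [card_bad] divided by [g ^+ 2], with one factor [g] from [c_ge] and one from
     [sum_ge]. *)
  have le_g : #|bad|%:R * (eps * sg) <= g.
    rewrite -(ler_pM2l (mulr_gt0 g0 g0)).
    apply: le_trans (_ : #|bad|%:R * c%:R * (\sum_i (s i)%:R ^+ d) <= _); last first.
      by apply: le_trans card_bad _; rewrite !exprS expr0 mulr1 mulrA.
    apply: le_trans (_ : #|bad|%:R * (eps * g) * (g * sg) <= _).
      by rewrite le_eqVlt; apply/orP; left; apply/eqP; ring.
    apply: ler_pM => //; first by rewrite !mulr_ge0 // ltW.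
      by rewrite mulr_ge0 // ltW.
    by rewrite ler_wpM2l.
  apply: le_trans (ler_wpM2l delta0 le_g).
  have := ler_wpM2l (ler0n R #|bad|) big_sum; rewrite mulr1 => /le_trans; apply.
  by rewrite le_eqVlt; apply/orP; left; apply/eqP; ring.
apply: (@covered_finite _ _ bad (@cell_lo p d) (@cell_hi p d)) => //.
- by move=> a i; rewrite /cell_lo /cell_hi ler_pM2r ?invr_gt0 // ler_nat.
- move=> x [x01 ncov]; exists (cell_of p x); last exact: cell_ofP.
  (* Were the cell of [x] not bad, the fewer than [c] cells that it misses would cover the missed
     set of [x]. *)
  rewrite inE leqNgt; apply/negP => Zlt; apply: ncov.
  apply: (@covered_finite _ _ (Z (cell_of p x)) (@cell_lo p d) (@cell_hi p d)) => //.
  + by move=> a i; rewrite /cell_lo /cell_hi ler_pM2r ?invr_gt0 // ler_nat.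
  + move=> y [y01 miss]; exists (cell_of p y); last exact: cell_ofP.
    rewrite inE; apply/forallP => i; apply/negP => ih.
    apply: (miss (nn i)); first by rewrite leq_addr.
    by apply: near_of_hit ih _ _ => //; apply: cell_ofP.
  under eq_bigr do rewrite box_vol_cell //.
  rewrite sumr_const -[leLHS]mulr_natl ler_pdivrMr ?exprn_gt0 //.
  rewrite ltnS in Zlt; apply: le_trans (_ : (c.-1)%:R <= _); first by rewrite ler_nat.
  by rewrite truncn_le mulr_ge0 ?exprn_ge0 // ltW.
under eq_bigr do rewrite box_vol_cell //.
by rewrite sumr_const -[leLHS]mulr_natl ler_pdivrMr ?exprn_gt0.
Qed.

(** * Null sets of exceptional points, in the unit cube and then in the whole space *)

Definition near_io d (rho : nat -> R) (x y : Rd d) : Prop :=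
  forall m, exists n, (m < n)%N /\ near rho n x y.

Definition exceptional d (rho : nat -> R) (x : Rd d) : Prop :=
  ~ negligible (fun y => unit_cube y /\ ~ near_io rho x y).

(** A countable union replaces Fubini. If for all [m] and [j] the set missed after [m + m0] has a
    cover of volume [1 / (j + 1)], then [x] is not exceptional; for each pair [(m, j)],
    [covered_bad] makes the points that fail this negligible. *)
Lemma negligible_exceptional_unit d (rho : nat -> R) m0 : (0 < d)%N ->
  (forall n, (m0 < n)%N -> 0 < rho n <= 1) ->
  (forall m M, exists K, M <= \sum_(i < K) rho (m.+1 + i)%N ^+ d) ->
  negligible (fun x : Rd d => unit_cube x /\ exceptional rho x).
Proof.
move=> d0 rho01 div.
pose C (q : nat * nat) (x : Rd d) :=
  unit_cube x /\ ~ covered (missed rho (q.1 + m0) x) (q.2.+1%:R^-1).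
apply: (@negligible_sub _ _ (fun x => exists q, C q x)) => [x [x01 exc]|].
  apply: contrapT => /forallNP nC; apply: exc.
  apply: (@negligible_sub _ _ (fun y => exists m, missed rho (m + m0) x y)).
    move=> y [y01] /existsNP[m /forallNP mP]; exists m; split=> // n mn nr.
    by apply: (mP n); split=> //; apply: leq_ltn_trans mn; exact: leq_addr.
  apply: negligible_bigcup => // m; apply/negligibleP => e e0.
  pose j := Num.truncn e^-1.
  apply: (@covered_le _ _ j.+1%:R^-1).
    by rewrite invf_ple ?posrE // ltW // truncnS_gt.
  by apply: contrapT => ncov; apply: (nC (m, j)).
apply: negligible_bigcup => // -[m j]; apply/negligibleP => e e0.
have eps0 : 0 < j.+1%:R^-1 :> R by rewrite invr_gt0.
(* The factor [2 ^+ d] compensates the halves in [covered_bad]. *)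
have [K hK] := div (m + m0)%N (2 ^+ d / (j.+1%:R^-1 * e)).
apply: (@covered_bad _ _ _ K) => //; first exact: ltW.
  by move=> n mn; apply: rho01; apply: leq_ltn_trans mn; exact: leq_addl.
under eq_bigr do rewrite exprMn exprVn.
rewrite -mulr_suml mulrA ler_pdivlMr ?exprn_gt0 // mul1r.
by rewrite ler_pdivrMr ?mulr_gt0 // mulrC in hK.
Qed.

Definition floor_vec d (x : Rd d) : {ffun 'I_d -> Z} := [ffun i => Int_part (x i)].

(** The vector [n c] is integral, so it is absorbed into [z]. *)
Lemma near_shift d (rho : nat -> R) n (c : {ffun 'I_d -> Z}) (x y : Rd d) :
  near rho n (vsub x (fun i => IZR (c i))) y -> near rho n x y.
Proof.
move=> h i; have [z hz] := h i.
exists (z - Z.of_nat n * c i)%Z.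
rewrite minus_IZR mult_IZR -INR_IZR_INZ INRE.
apply: le_trans hz; rewrite /vsub !RminusE RmultE le_eqVlt.
by apply/orP; left; apply/eqP; congr `|_|; ring.
Qed.

(** Subtracting its integer parts moves [x] into the unit cube and, by [near_shift], keeps it
    exceptional; there are countably many integer vectors. *)
Lemma negligible_exceptional d (rho : nat -> R) m0 : (0 < d)%N ->
  (forall n, (m0 < n)%N -> 0 < rho n <= 1) ->
  (forall m M, exists K, M <= \sum_(i < K) rho (m.+1 + i)%N ^+ d) ->
  negligible (fun x : Rd d => exceptional rho x).
Proof.
move=> d0 rho01 div.
have n0 := negligible_exceptional_unit d0 rho01 div.
pose A (c : {ffun 'I_d -> Z}) (x : Rd d) :=
  let x' := vsub x (fun i => IZR (c i)) in unit_cube x' /\ exceptional rho x'.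
apply: (@negligible_sub _ _ (fun x => exists c, A c x)) => [x exc|]; last first.
  by apply: negligible_bigcup => // c; apply: negligible_translate n0.
exists (floor_vec x); split=> [i|].
  rewrite /vsub ffunE RminusE; have [] := base_Int_part (x i).
  move=> /RleP lo /RltP; rewrite RminusE (opp_IZR 1) RoppE R1E => hi.
  by apply/andP; split; lra.
apply: contra_not exc; apply: negligible_sub => y [y01 h]; split=> //.
by apply: contra_not h => h m; have [n [mn /near_shift nr]] := h m; exists n.
Qed.



(** * Norms, fractional parts, and the theorem *)

Section Norm.

Variables (d : nat) (N : Rd d -> R).
Hypothesis N_norm : is_norm N.

Let unit_vec (i : 'I_d) : Rd d := fun j => (i == j)%:R.

(** A constant that bounds [N] by a multiple of the maximum norm. *)
Definition norm_bound : R := \sum_i N (unit_vec i).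

Lemma norm0 : N (fun=> 0) = 0.
Proof.
have [_ [homog _]] := N_norm.
have -> : (fun=> 0) = vscal 0 (fun=> 0) :> Rd d.
  by apply/funext => i; rewrite /vscal RmultE mulr0.
by rewrite homog RmultE RabsE normr0 mul0r.
Qed.

(** The triangle inequality for [w] and [-w] gives [0 <= 2 * N w]. *)
Lemma norm_ge0 w : 0 <= N w.
Proof.
have [_ [homog triangle]] := N_norm.
have := triangle w (vscal (-1) w); rewrite homog.
have -> : vadd w (vscal (-1) w) = fun=> 0.
  by apply/funext => i; rewrite /vadd /vscal RplusE RmultE mulN1r subrr.
by rewrite norm0 RabsE normrN1 RmultE mul1r RplusE => /RleP; lra.
Qed.

(** The coordinates of [w] are switched on one at a time, each costing at most [e] times the norm of
    a unit vector. *)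
Lemma norm_le_coord (w : Rd d) (e : R) : (forall i, `|w i| <= e) -> N w <= e * norm_bound.
Proof.
move=> we; have [_ [homog triangle]] := N_norm.
have partial (s : seq 'I_d) : uniq s ->
    N (fun i => if i \in s then w i else 0) <= \sum_(i <- s) e * N (unit_vec i).
  elim: s => [_|j s IH /= /andP[js /IH {}IH]]; first by rewrite norm0 big_nil.
  rewrite big_cons.
  have -> : (fun i => if i \in j :: s then w i else 0) =
      vadd (vscal (w j) (unit_vec j)) (fun i => if i \in s then w i else 0).
    apply/funext => i; rewrite /vadd /vscal /unit_vec RplusE RmultE inE.
    have [->|_] /= := eqVneq i j; first by rewrite (negbTE js) mulr1 addr0.
    by rewrite mulr0 add0r.
  apply: le_trans (introT RleP (triangle _ _)) _.
  by rewrite RplusE lerD // homog RmultE RabsE ler_wpM2r ?norm_ge0.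
have := partial (enum 'I_d) (enum_uniq _).
have -> : (fun i => if i \in enum 'I_d then w i else 0) = w.
  by apply/funext => i; rewrite mem_enum.
by rewrite big_enum /= mulr_sumr.
Qed.

End Norm.

(** * Fractional parts and sequences of the class [in_Pd] *)

Lemma frac_part_unique (x t : R) (z : Z) : 0 <= t < 1 -> x = t + IZR z -> frac_part x = t.
Proof.
move=> /andP[t0 t1] xE; rewrite /frac_part.
have <- : z = Int_part x.
  by apply: Int_part_spec; split; [apply/RltP|apply/RleP]; rewrite ?RminusE ?R1E xE; lra.
by rewrite RminusE xE addrK.
Qed.

(** A decreasing sequence with limit 0 is nonnegative; a zero term would make all later terms vanish
    and, as [0 < d], bound the series of powers. *)
Lemma Pd_gt0 d r : (0 < d)%N -> in_Pd d r -> forall n, (0 < n)%N -> 0 < r n.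
Proof.
move=> d0 [dec [cv div]].
have mono n k : (0 < n)%N -> r (n + k)%N <= r n.
  move=> n0; elim: k => [|k IH]; first by rewrite addn0.
  by rewrite addnS (le_trans _ IH) //; apply/RleP/dec; rewrite addn_gt0 n0.
have r0 n : (0 < n)%N -> 0 <= r n.
  move=> n0; rewrite leNgt; apply/negP => rn.
  have [|m hm] := cv (- r n); first by apply/RltP; rewrite oppr_gt0.
  have /RltP := hm (n + m)%coq_nat (Nat.le_add_l _ _).
  rewrite /Rdist RabsE RminusE subr0 => h.
  have := mono n m n0; have := ler_norm (- r (n + m)%N); rewrite normrN.
  rewrite plusE in h; lra.
move=> n n0; rewrite lt_def r0 // andbT; apply/eqP => rn.
have r_eq0 k : (n <= k)%N -> r k = 0.
  move=> nk; apply/eqP; rewrite eq_le r0 ?(leq_trans n0) // andbT -rn.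
  by rewrite -(subnKC nk) mono.
have [K /RltP] := div (\sum_(0 <= k < n) r k.+1 ^+ d).
rewrite sum_f_R0E ltNge => /negP[].
rewrite (eq_bigr (fun k => r k.+1 ^+ d)); last by move=> k _; rewrite RpowE.
have r_ge0 k : 0 <= r k.+1 ^+ d by rewrite exprn_ge0 // r0.
have [nK|Kn] := leqP n K.+1; last first.
  rewrite (@big_cat_nat _ _ _ K.+1 0 n) ?(ltnW Kn) //=.
  by rewrite lerDl sumr_ge0 // => k _; apply: r_ge0.
rewrite (@big_cat_nat _ _ _ n 0 K.+1) //= gerDl big_nat big1 // => k /andP[nk _].
by rewrite r_eq0 ?expr0n ?gtn_eqF // leqW.
Qed.

(** Divergence is applied to the target [M] increased by the first [m] terms. *)
Lemma Pd_tail_sum d r : (0 < d)%N -> in_Pd d r ->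
  forall m M, exists K, M <= \sum_(i < K) r (m.+1 + i)%N ^+ d.
Proof.
move=> d0 Hr m M; have rpos := Pd_gt0 d0 Hr; have [_ [_ div]] := Hr.
have [n /RltP] := div (\sum_(0 <= k < m) r k.+1 ^+ d + M).
rewrite sum_f_R0E => h; exists n.+1.
rewrite -(lerD2l (\sum_(0 <= k < m) r k.+1 ^+ d)) ltW // (lt_le_trans h) //.
rewrite -(big_mkord xpredT (fun i => r (m.+1 + i)%N ^+ d)).
have -> : \sum_(0 <= i < n.+1) r (m.+1 + i)%N ^+ d = \sum_(m <= k < m + n.+1) r k.+1 ^+ d.
  have := @big_addn R 0 +%R 0 (m + n.+1) m xpredT (fun k => r k.+1 ^+ d).
  by rewrite add0n addKn => ->; apply: eq_bigr => i _; rewrite addSn addnC.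
rewrite -(@big_cat_nat _ _ _ m 0 (m + n.+1)) ?leq_addr //=.
rewrite (@big_cat_nat _ _ _ n.+1 0 (m + n.+1)) ?leq_addl //=.
rewrite (eq_bigr (fun k => r k.+1 ^+ d)); last by move=> k _; rewrite RpowE.
by rewrite lerDl sumr_ge0 // => k _; rewrite exprn_ge0 // ltW // rpos.
Qed.

Theorem theorem11p1 (d : nat) (Hd : (0 < d)%nat) (N : Rd d -> R) (HN : is_norm N)
  (r : nat -> R) (Hr : in_Pd d r) :
  ae (fun x : Rd d => eutaxic_frac N r x).
Proof.
(* Adding 1 makes [C] positive, and the 2 in [rho] gives the strict bound [N w <= rho n * norm_bound
   N < rho n * C = r n / 2 < r n]. *)
pose C := norm_bound N + 1.
have C0 : 0 < C.
  by rewrite ltr_wpDl // /C sumr_ge0 // => i _; apply: norm_ge0.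
pose rho n := r n / (2 * C).
have r0 := Pd_gt0 Hd Hr.
have [_ [cv _]] := Hr.
have small (e : R) : 0 < e -> exists m, forall n, (m < n)%N -> rho n < e.
  move=> e0; have [|m hm] := cv (e * (2 * C)).
    by apply/RltP; rewrite !mulr_gt0.
  exists m => n mn; have /RltP := hm n (elimT ssrnat.leP (ltnW mn)).
  rewrite /Rdist RabsE RminusE subr0 => h.
  by rewrite /rho ltr_pdivrMr ?mulr_gt0 // (le_lt_trans (ler_norm _) h).
have [m0 hm0] := small 1 ltr01.
have rho01 n : (m0 < n)%N -> 0 < rho n <= 1.
  move=> mn; rewrite ltW ?hm0 // andbT divr_gt0 ?mulr_gt0 // r0 //.
  exact: leq_ltn_trans mn.
have div m M : exists K, M <= \sum_(i < K) rho (m.+1 + i)%N ^+ d.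
  have [K hK] := Pd_tail_sum Hd Hr m (M * (2 * C) ^+ d); exists K.
  under eq_bigr do rewrite exprMn exprVn.
  by rewrite -mulr_suml ler_pdivlMr // exprn_gt0 // mulr_gt0.
apply: negligible_sub (negligible_exceptional Hd rho01 div) => x.
apply: contra_not; apply: negligible_sub => y /not_implyP[y01 miss]; split.
  by move=> i; have [/RltP ? /RltP ?] := y01 i; apply/andP; split=> //; apply: ltW.
apply: contra_not miss => io m.
(* A lower bound for the distance from [y] to the faces of the cube. Once [rho n < e], the integer
   translate of [n x] close to [y] lies inside the cube, so it is the fractional part itself. *)
have [e e0 he] : exists2 e : R, 0 < e & forall i, e <= y i /\ e <= 1 - y i.
  exists (\big[Num.min/1]_i Num.min (y i) (1 - y i)).
    apply/bigmin_gtP; split=> // i _; have [/RltP ? /RltP ?] := y01 i.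
    by rewrite lt_min subr_gt0; apply/andP.
  move=> i; have := bigmin_le_cond 1 (fun i => Num.min (y i) (1 - y i)) (isT : xpredT i).
  by rewrite le_min => /andP.
have [m1 hm1] := small e e0.
have [n [mn nr]] := io (maxn m m1).
have [mn1 mn2] : (m < n)%N /\ (m1 < n)%N by move: mn; rewrite gtn_max => /andP.
exists n; split=> //; apply/RltP.
set w := vsub _ _.
have wE i : `|w i| <= rho n.
  have [z] := nr i; pose t := y i - n%:R * x i - IZR z; rewrite -/t => ht.
  suff -> : w i = t by [].
  rewrite /w /vsub /vfrac RminusE.
  pose u := y i - t.
  rewrite (@frac_part_unique _ u (Z.opp z)); first by rewrite /u subKr.
    have [e1 e2] := he i; have t_lt : `|t| < e := le_lt_trans ht (hm1 n mn2).
    rewrite /u; clearbody t; move: t_lt; rewrite ltr_norml => /andP[lo hi].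
    by apply/andP; split; lra.
  by rewrite /vscal RmultE INRE opp_IZR RoppE /u /t; ring.
have : N w <= rho n * norm_bound N by apply: norm_le_coord.
have rn0 : 0 < r n by apply: r0; exact: leq_ltn_trans mn1.
have : rho n * C < r n.
  by rewrite /rho invfM mulrA divfK ?gt_eqF // ltr_pdivrMr // ltr_pMr // ltr1n.
have : 0 < rho n by rewrite divr_gt0 // mulr_gt0.
rewrite /C; lra.
Qed.
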